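(* Let $A$ be a finite dimensional C$^*$-algebra and let $\Delta:A\to A$ be a weak-2-local $^*$-derivation. Then $\Delta$ is a derivation.
   Context: A derivation on a C$^*$-algebra $A$ is a (complex) linear map $D:A\to A$ with $D(ab)=D(a)b+aD(b)$ for all $a,b\in A$; it is a $^*$-derivation if moreover $D(a^* )=D(a)^*$ for all $a\in A$. $A^*$ denotes the space of bounded linear functionals on $A$. A (not necessarily linear) mapping $\Delta:A\to A$ is a weak-2-local $^*$-derivation if for every $a,b\in A$ and every $\phi\in A^*$ there exists a $^*$-derivation $D_{a,b,\phi}:A\to A$, depending on $a$, $b$ and $\phi$, such that $\phi(\Delta(a))=\phi(D_{a,b,\phi}(a))$ and $\phi(\Delta(b))=\phi(D_{a,b,\phi}(b))$. *)

(* Defs.v *)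
From HB Require Import structures.
From mathcomp Require Import all_boot all_order all_algebra.
From mathcomp Require Import complex.
From mathcomp Require Import boolp classical_sets reals topology normedtype.

Set Implicit Arguments.
Unset Strict Implicit.
Unset Printing Implicit Defensive.

Import Order.TTheory GRing.Theory Num.Theory.

Local Open Scope ring_scope.
Local Open Scope complex_scope.

(* C*-algebras need not be unital, whereas all MathComp rings are: the product *)
(* is therefore part of the mixin. The norm `|x| of a normed module over R[i]  *)
(* takes its values in R[i], ordered by: x <= y iff y - x is real nonnegative. *)
HB.mixin Record CompleteNormedModule_isCstarAlgebra (R : realType) A
    & CompleteNormedModule R[i] A := {
  cmul : A -> A -> A;
  cstar : A -> A;
  cmulA : forall x y z : A, cmul x (cmul y z) = cmul (cmul x y) z;
  cmulDl : forall x y z : A, cmul (x + y) z = cmul x z + cmul y z;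
  cmulDr : forall x y z : A, cmul x (y + z) = cmul x y + cmul x z;
  cmulZl : forall (k : R[i]) (x y : A), cmul (k *: x) y = k *: cmul x y;
  cmulZr : forall (k : R[i]) (x y : A), cmul x (k *: y) = k *: cmul x y;
  cstarD : forall x y : A, cstar (x + y) = cstar x + cstar y;
  cstarZ : forall (k : R[i]) (x : A), cstar (k *: x) = (k^*)%R *: cstar x;
  cstarM : forall x y : A, cstar (cmul x y) = cmul (cstar y) (cstar x);
  cstarK : forall x : A, cstar (cstar x) = x;
  cnormM : forall x y : A, `|cmul x y| <= `|x| * `|y|;
  cnorm_star : forall x : A, `|cmul (cstar x) x| = `|x| ^+ 2
}.

#[short(type="cstarAlgType")]
HB.structure Definition CstarAlgebra (R : realType) :=
  {A of CompleteNormedModule R[i] A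
      & CompleteNormedModule_isCstarAlgebra R A}.

#[short(type="finDimCstarAlgType")]
HB.structure Definition FinDimCstarAlgebra (R : realType) :=
  {A of CstarAlgebra R A & Vector R[i] A}.

Section Derivations.
Variables (R : realType) (A : cstarAlgType R).
Implicit Types (D Delta : A -> A) (phi : A -> R[i]).

Definition is_derivation D : Prop :=
  linear D /\ forall a b : A, D (cmul a b) = cmul (D a) b + cmul a (D b).

Definition is_star_derivation D : Prop :=
  is_derivation D /\ forall a : A, D (cstar a) = cstar (D a).

Definition is_bounded_functional phi : Prop :=
  scalar phi /\ exists M : R, forall a : A, `|phi a| <= M%:C * `|a|.

Definition is_weak_2_local_star_derivation Delta : Prop :=
  forall (a b : A) phi, is_bounded_functional phi ->
    exists D : A -> A, [/\ is_star_derivation D,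
      phi (Delta a) = phi (D a) & phi (Delta b) = phi (D b)].

End Derivations.

(* Main.v *)
From HB Require Import structures.
Require Import Defs.
From mathcomp Require Import all_boot all_order all_algebra.
From mathcomp Require Import complex.
From mathcomp Require Import boolp classical_sets reals topology normedtype.
From mathcomp Require Import spectral ring.

(** Everything rests on the trace of the regular representation,
    [tau x = trace of (v |-> x v)]. It satisfies [tau (x y) = tau (y x)]; it
    vanishes on the image of every derivation [D], because left multiplication
    by [D x] is the commutator of [D] with left multiplication by [x]; it is
    bounded, since an eigenvalue of the multiplication by [x] is at most [|x|];
    and the form [tau (x y)] is nondegenerate ([regtr_nondegenerate]). For the
    last point, multiplication by a selfadjoint [s] has real eigenvalues, so
    [tau (s s)] is a sum of squares; if it is zero, then the multiplication is
    nilpotent, and the C*-identity forces [s = 0].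

    Linearity of [Delta]. The functionals [tau (h _)] may be used in the
    hypothesis. A derivation satisfies [tau (h (D h)) = tau (D (h h)) / 2 = 0];
    testing at the pairs [(b, b)] and [(c + b, c)] gives
    [tau (b (Delta b)) = 0] and [tau (b (Delta (c + b))) = tau (b (Delta c))].
    Hence the form [B h a = tau (h (Delta a))] is skew ([form_skew]). It is
    linear in [h] by definition, so it is linear in [a] as well, and [Delta] is
    linear by nondegeneracy.

    Leibniz rule. Likewise [tau (a a (D a)) = tau (D (a a a)) / 3 = 0], hence
    [tau (a a (Delta a)) = 0]. The part of this cubic identity that is linear
    in a second variable [c], combined with the skewness of [B], says that
    [Delta (a a) = Delta a a + a Delta a], i.e. that [Delta] is a Jordan
    derivation. By Herstein's theorem a Jordan derivation of a semiprime algebra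
    without 2-torsion is a derivation ([jordan_derivation_leibniz]), and a
    C*-algebra is semiprime. *)

Set Implicit Arguments.
Unset Strict Implicit.
Unset Printing Implicit Defensive.

Import Order.TTheory GRing.Theory Num.Theory.

Local Open Scope ring_scope.
Local Open Scope complex_scope.

Local Notation "x ** y" := (cmul x y) (at level 40, left associativity).

(** * Trace and eigenvalues of a linear operator *)

Section Operators.
Import VectorInternalTheory.
Variables (C : numClosedFieldType) (V : vectType C).
Implicit Types f g : V -> V.

(** Coordinates are row vectors, hence operators act on the right and
    composition reverses products. *)
Definition op_mx f : 'M[C]_(dim V) := lin1_mx (v2r \o f \o r2v).

Definition op_trace f : C := \tr (op_mx f).

Lemma op_mxE f v : linear f -> v2r (f v) = v2r v *m op_mx f.
Proof.
move=> f_lin.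
pose F : {linear V -> V} := HB.pack f (GRing.isLinear.Build _ _ _ _ f f_lin).
by have := mul_rV_lin1 (v2r \o F \o r2v) (v2r v); rewrite /= v2rK => <-.
Qed.

Lemma op_mx_uniq f (M : 'M_(dim V)) :
  (forall v, v2r (f v) = v2r v *m M) -> op_mx f = M.
Proof.
move=> fE; apply/matrixP => i j.
by rewrite mxE /= fE r2vK -rowE mxE.
Qed.

Lemma op_mx_comp f g : linear f -> linear g ->
  op_mx (f \o g) = op_mx g *m op_mx f.
Proof.
move=> f_lin g_lin; apply: op_mx_uniq => v /=.
by rewrite (op_mxE _ f_lin) (op_mxE _ g_lin) mulmxA.
Qed.

Lemma op_trace_comp f g : linear f -> linear g ->
  op_trace (f \o g) = op_trace (g \o f).
Proof.
move=> f_lin g_lin.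
by rewrite /op_trace (op_mx_comp f_lin g_lin) (op_mx_comp g_lin f_lin) mxtrace_mulC.
Qed.

Lemma op_mx_iter f k v : linear f ->
  v2r (iter k f v) = v2r v *m iter k (mulmx (op_mx f)) 1%:M.
Proof.
move=> f_lin; elim: k v => [|k IHk] v; first by rewrite mulmx1.
by rewrite iterSr IHk (op_mxE _ f_lin) iterS mulmxA.
Qed.

(** Read off a Schur triangularization: the diagonal [l] lists the eigenvalues
    with multiplicity, so the traces are power sums of [l], and if [l] vanishes
    then the characteristic polynomial is a power of ['X] and Cayley-Hamilton
    gives nilpotency. *)
Lemma mx_triangular n (M : 'M[C]_n) : exists l : 'I_n -> C,
  [/\ forall i, exists2 v : 'rV_n, v != 0 & v *m M = l i *: v,
      \tr M = \sum_i l i,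
      \tr (M *m M) = \sum_i l i ^+ 2 &
      (forall i, l i = 0) -> iter n (mulmx M) 1%:M = 0].
Proof.
case: n M => [|n] M.
  exists (fun=> 0); split; rewrite ?big_ord0 /mxtrace ?big_ord0 //; first by case.
  by move=> _; apply: flatmx0.
have [P /unitarymx_unit Pu] := Schur M (ltn0Sn n).
rewrite /similar_to/= conjumx //; set T := P *m M *m invmx P => Ttrig.
have ME : M = invmx P *m T *m P by rewrite /T !mulmxA mulVmx // mul1mx mulmxKV.
clearbody T.
(* In the (i, i) entry of T *m T, one factor of each product T i j * T j i
   with j != i lies above the diagonal. *)
have Tdiag i : (T *m T) i i = T i i ^+ 2.
  rewrite mxE (bigD1 i) //= big1 ?addr0 // => j /negPf ij.
  have /is_trig_mxP Tz := Ttrig.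
  case: (ltngtP i j) => [/Tz->|/Tz->|/val_inj eij]; rewrite ?mul0r ?mulr0 //.
  by rewrite eij eqxx in ij.
exists (fun i => T i i); split.
- move=> i; have : eigenvalue T (T i i).
    rewrite eigenvalue_root_char char_poly_trig // /root horner_prod.
    by rewrite (bigD1 i) //= hornerXsubC subrr mul0r.
  case/eigenvalueP => u uT u0; exists (u *m P).
    apply: contra_neq u0 => /(congr1 (mulmx^~ (invmx P))).
    by rewrite mulmxK // mul0mx.
  by rewrite ME !mulmxA mulmxK // uT scalemxAl.
- by rewrite ME mxtrace_mulC mulmxA mulmxV // mul1mx.
- rewrite ME -!mulmxA mxtrace_mulC !mulmxA mulmxK // mulmxK //.
  by apply: eq_bigr => i _; rewrite Tdiag.
- move=> T0; have Tn0 : T ^+ n.+1 = 0.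
    have := Cayley_Hamilton T; rewrite char_poly_trig //.
    under eq_bigr do rewrite T0 subr0.
    by rewrite prodr_const card_ord rmorphXn /= horner_mx_X.
  suff ME' k : iter k (mulmx M) 1%:M = invmx P *m T ^+ k *m P.
    by apply: etrans (ME' n.+1) _; rewrite Tn0 mulmx0 mul0mx.
  elim: k => [|k IHk]; first by rewrite expr0 mulmx1 mulVmx.
  by rewrite iterS IHk exprS {1}ME !mulmxA mulmxK.
Qed.

Lemma op_triangular f : linear f -> exists l : 'I_(dim V) -> C,
  [/\ forall i, exists2 v, v != 0 & f v = l i *: v,
      op_trace f = \sum_i l i,
      op_trace (f \o f) = \sum_i l i ^+ 2 &
      (forall i, l i = 0) -> forall v, iter (dim V) f v = 0].
Proof.
move=> f_lin; have [l [eig tr1 tr2 nil]] := mx_triangular (op_mx f).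
exists l; split => //.
- move=> i; have [v v0 vM] := eig i; exists (r2v v).
    by apply: contra_neq v0 => /(congr1 v2r); rewrite r2vK linear0.
  by apply: v2r_inj; rewrite (op_mxE _ f_lin) r2vK vM linearZ /= r2vK.
- by rewrite /op_trace (op_mx_comp f_lin f_lin).
- move=> l0 v; apply: v2r_inj.
  by rewrite op_mx_iter // nil // mulmx0 linear0.
Qed.

End Operators.

(** * Algebra of the C*-identity *)

Section Cstar.
Variables (R : realType) (A : cstarAlgType R).
Implicit Types x y z s v : A.

Lemma cmul0l x : 0 ** x = 0.
Proof. by rewrite -(scale0r x) cmulZl !scale0r. Qed.

Lemma cmul0r x : x ** 0 = 0.
Proof. by rewrite -(scale0r x) cmulZr !scale0r. Qed.

Lemma cmulNl x y : - x ** y = - (x ** y).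
Proof. by rewrite -scaleN1r cmulZl scaleN1r. Qed.

Lemma cmulNr x y : x ** - y = - (x ** y).
Proof. by rewrite -scaleN1r cmulZr scaleN1r. Qed.

Lemma cstar0 : cstar 0 = 0 :> A.
Proof. by rewrite -(scale0r (0 : A)) cstarZ conjC0 !scale0r. Qed.

Lemma cmull_linear x : linear (cmul x).
Proof. by move=> k y z; rewrite cmulDr cmulZr. Qed.

Lemma cstar_mul_eq0 x : cstar x ** x = 0 -> x = 0.
Proof.
move=> xx0; have := cnorm_star x; rewrite xx0 normr0 => /esym/eqP.
by rewrite expf_eq0 /= normr_eq0 => /eqP.
Qed.

(** [(s v)* (s v) = v* (s (s v))] for selfadjoint [s]: multiplication by [s]
    has no nilpotent part. *)
Lemma selfadj_mul_eq0 s v : cstar s = s -> s ** (s ** v) = 0 -> s ** v = 0.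
Proof.
move=> ss ssv0; apply: cstar_mul_eq0.
by rewrite cstarM ss -cmulA ssv0 cmul0r.
Qed.

Lemma selfadj_iter_eq0 s k v : cstar s = s ->
  iter k (cmul s) v = 0 -> s ** v = 0.
Proof.
move=> ss; elim: k v => [|k IHk] v; first by move=> /= ->; rewrite cmul0r.
by rewrite iterSr => /IHk; apply: selfadj_mul_eq0.
Qed.

Lemma selfadj_sqr_eq0 s : cstar s = s -> s ** s = 0 -> s = 0.
Proof. by move=> ss ss0; apply: cstar_mul_eq0; rewrite ss. Qed.

(** With [c = x*], the square of the selfadjoint element [x* x] vanishes. *)
Lemma cstar_semiprime x : (forall c, x ** c ** x = 0) -> x = 0.
Proof.
move=> xcx0; apply/cstar_mul_eq0/selfadj_sqr_eq0; first by rewrite cstarM cstarK.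
by rewrite -cmulA (cmulA x) xcx0 cmul0r.
Qed.

(** The selfadjoint element [v* (s v)] equals [k (v* v)], and [v* v] is
    selfadjoint and nonzero. *)
Lemma selfadj_eigen_real s v (k : R[i]) : cstar s = s ->
  v != 0 -> s ** v = k *: v -> k \is Num.real.
Proof.
move=> ss v0 sv; rewrite CrealE.
have vv0 : cstar v ** v != 0 by apply: contra_neq v0 => /cstar_mul_eq0.
have : cstar (cstar v ** (s ** v)) = cstar v ** (s ** v).
  by rewrite !cstarM cstarK ss cmulA.
rewrite sv cmulZr cstarZ cstarM cstarK => /eqP.
by rewrite -subr_eq0 -scalerBl scaler_eq0 (negPf vv0) orbF subr_eq0.
Qed.

Lemma eigen_bound x v (k : R[i]) : v != 0 -> x ** v = k *: v -> `|k| <= `|x|.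
Proof.
move=> v0 xv; rewrite -(ler_pM2r (x := `|v|)) ?normr_gt0 //.
by rewrite -normrZ -xv cnormM.
Qed.

End Cstar.

Section Semiprime.
Variables (R : realType) (A : cstarAlgType R).
Implicit Types x y z s v : A.

Lemma addxx_eq0 x : x + x = 0 -> x = 0.
Proof.
by move=> /eqP; rewrite -mulr2n -scaler_nat scaler_eq0 pnatr_eq0 => /eqP.
Qed.

Lemma semiprime_swap x y : (forall c, x ** c ** y = 0) ->
  forall c, y ** c ** x = 0.
Proof.
move=> xy0 c; apply: cstar_semiprime => z.
have -> : y ** c ** x ** z ** (y ** c ** x) = y ** c ** (x ** z ** y) ** c ** x.
  by rewrite !cmulA.
by rewrite xy0 cmul0r !cmul0l.
Qed.

(** In a semiprime algebra without 2-torsion, moving [x] past [y] at the cost of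
    a sign, as the hypothesis permits, three times inside
    [w = (x c y) z (x c y)] gives [w = - w]. *)
Lemma semiprime_anti x y : (forall c, x ** c ** y + y ** c ** x = 0) ->
  forall c, x ** c ** y = 0.
Proof.
move=> xy c; apply: cstar_semiprime => z.
have yx e : y ** e ** x = - (x ** e ** y).
  by apply/eqP; rewrite -addr_eq0 addrC xy.
set w := LHS; apply: addxx_eq0; apply/eqP; rewrite addr_eq0; apply/eqP.
have {1}-> : w = x ** c ** (y ** z ** x) ** c ** y by rewrite /w !cmulA.
rewrite yx.
have -> : x ** c ** - (x ** z ** y) ** c ** y
    = - (x ** (c ** x ** z) ** y) ** c ** y.
  by rewrite !(cmulNl, cmulNr, cmulA).
rewrite -yx.
have -> : y ** (c ** x ** z) ** x ** c ** y = y ** c ** x ** z ** x ** c ** y.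
  by rewrite !cmulA.
by rewrite yx /w !(cmulNl, cmulA).
Qed.

End Semiprime.

(** * The trace of the regular representation *)

Section Trace.
Import VectorInternalTheory.
Variables (R : realType) (A : finDimCstarAlgType R).
Implicit Types x y z s : A.

(** The trace of the left regular representation: a tracial functional whose
    form is nondegenerate, obtained without decomposing [A] into matrix blocks. *)
Definition regtr x : R[i] := op_trace (cmul x).

Lemma regtr_linear : scalar regtr.
Proof.
move=> k x y; rewrite /regtr /op_trace.
suff -> : op_mx (cmul (k *: x + y)) = k *: op_mx (cmul x) + op_mx (cmul y).
  by rewrite mxtraceD mxtraceZ.
apply: op_mx_uniq => v; rewrite cmulDl cmulZl linearD linearZ /=.
rewrite (op_mxE _ (cmull_linear x)) (op_mxE _ (cmull_linear y)).
by rewrite mulmxDr -scalemxAr.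
Qed.

HB.instance Definition _ :=
  GRing.isLinear.Build R[i] A R[i] *%R regtr regtr_linear.

Lemma regtrC x y : regtr (x ** y) = regtr (y ** x).
Proof.
rewrite /regtr; have E a b : cmul (a ** b) = (cmul a : A -> A) \o cmul b.
  by apply/funext => v /=; rewrite cmulA.
by rewrite !E op_trace_comp //; apply: cmull_linear.
Qed.

(** By the Leibniz rule, left multiplication by [D x] is the commutator of [D]
    with left multiplication by [x]. *)
Lemma regtr_derivation (D : A -> A) x : is_derivation D -> regtr (D x) = 0.
Proof.
move=> [D_lin DM]; rewrite /regtr /op_trace.
have L_lin := @cmull_linear _ A x.
suff -> : op_mx (cmul (D x))
    = op_mx (cmul x) *m op_mx D - op_mx D *m op_mx (cmul x).
  by rewrite raddfB /= mxtrace_mulC subrr.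
apply: op_mx_uniq => v; rewrite mulmxBr !mulmxA.
rewrite -(op_mxE _ L_lin) -(op_mxE _ D_lin) -(op_mxE _ D_lin) -(op_mxE _ L_lin).
by rewrite -linearB /= DM addrK.
Qed.

(** [tau (h (D h))] is half of [tau (D (h h))]. *)
Lemma regtr_derivation_self (D : A -> A) h : is_derivation D ->
  regtr (h ** D h) = 0.
Proof.
move=> Dder; have := regtr_derivation (h ** h) Dder.
rewrite (proj2 Dder) linearD /= (regtrC (D h)) => /eqP.
by rewrite -mulr2n mulrn_eq0 => /eqP.
Qed.

(** [tau (a a (D a))] is a third of [tau (D (a a a))]. *)
Lemma regtr_derivation_sqr (D : A -> A) a : is_derivation D ->
  regtr (a ** a ** D a) = 0.
Proof.
move=> Dder; have := regtr_derivation (a ** a ** a) Dder.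
rewrite !(proj2 Dder) cmulDl !linearD /= -cmulA regtrC -(cmulA a) (regtrC a).
move=> /eqP.
by rewrite -mulr2n -mulrSr mulrn_eq0 => /eqP.
Qed.

(** The trace is a sum of [dim A] eigenvalues, each bounded by [|x|]. *)
Lemma regtr_bounded x : `|regtr x| <= (dim A)%:R * `|x|.
Proof.
rewrite /regtr; have [l [eig -> _ _]] := op_triangular (cmull_linear x).
apply: le_trans (ler_norm_sum _ _ _) _.
have -> : (dim A)%:R * `|x| = \sum_(i < dim A) `|x|.
  by rewrite sumr_const card_ord mulr_natl.
apply: ler_sum => i _.
by have [v v0] := eig i; apply: eigen_bound.
Qed.

(** The trace is a sum of squares of real eigenvalues; if it vanishes they are
    all zero and left multiplication by [s] is nilpotent. *)
Lemma regtr_selfadj_sqr_eq0 s : cstar s = s -> regtr (s ** s) = 0 -> s = 0.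
Proof.
move=> ss; have [l [eig _ tr2 nil]] := op_triangular (cmull_linear s).
have -> : regtr (s ** s) = op_trace ((cmul s : A -> A) \o cmul s).
  by congr op_trace; apply/funext => v /=; rewrite cmulA.
rewrite tr2 => /eqP.
rewrite psumr_eq0; last first.
  move=> i _; have [v v0 sv] := eig i.
  by rewrite real_exprn_even_ge0 // (selfadj_eigen_real ss v0 sv).
move=> /allP l0; apply/(selfadj_sqr_eq0 ss)/(selfadj_iter_eq0 ss (k := dim A)).
apply: nil => i; have := l0 i (mem_index_enum i).
by rewrite /= expf_eq0 => /eqP.
Qed.

(** Testing against [y = x* x x*] gives [tau (p p) = 0] for the selfadjoint
    element [p = x x*]. *)
Lemma regtr_nondegenerate x : (forall y, regtr (y ** x) = 0) -> x = 0.
Proof.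
move=> x0; have xx0 : x ** cstar x = 0.
  apply: regtr_selfadj_sqr_eq0; first by rewrite cstarM cstarK.
  by rewrite -cmulA regtrC x0.
rewrite -[x]cstarK (cstar_mul_eq0 (x := cstar x)) ?cstarK //.
exact: cstar0.
Qed.

Lemma regtr_mul_bounded h : is_bounded_functional (fun x => regtr (h ** x)).
Proof.
split=> [k x y|]; first by rewrite cmulDr cmulZr linearP.
exists ((dim A)%:R * complex.Re `|h|) => x.
apply: le_trans (regtr_bounded _) _.
rewrite rmorphM rmorph_nat /= RRe_real ?normr_real // -mulrA.
by rewrite ler_wpM2l ?ler0n // cnormM.
Qed.

Lemma regtrD x y : regtr (x + y) = regtr x + regtr y. Proof. exact: linearD. Qed.

Lemma regtrN x : regtr (- x) = - regtr x. Proof. exact: linearN. Qed.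

Lemma regtr_ext x y : (forall z, regtr (z ** x) = regtr (z ** y)) -> x = y.
Proof.
move=> xy; apply/eqP; rewrite -subr_eq0; apply/eqP/regtr_nondegenerate => z.
by rewrite cmulDr cmulNr linearB /= xy subrr.
Qed.

(** Elements of [A] are separated by additive maps into a commutative ring. This
    turns an identity between sums of noncommutative words into a commutative
    one whose indeterminates are the images of the words. The ring [K] is
    abstract so that normalization never unfolds the complex numbers. *)
Lemma additive_ext x y :
  (forall (K : comPzRingType) (f : A -> K), {morph f : a b / a + b} ->
     {morph f : a / - a} -> f 0 = 0 -> f x = f y) -> x = y.
Proof.
move=> xy; apply: regtr_ext => z; apply: (xy R[i] (fun x => regtr (z ** x))).
- by move=> a b; rewrite cmulDr linearD.
- by move=> a; rewrite cmulNr linearN.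
- by rewrite cmul0r linear0.
Qed.

End Trace.

(** * Jordan derivations are derivations *)

Section JordanDerivation.
Variables (R : realType) (A : finDimCstarAlgType R).
Variable d : A -> A.
Hypothesis d_add : {morph d : x y / x + y}.
Hypothesis d_sqr : forall x, d (x ** x) = d x ** x + x ** d x.
Implicit Types a b c t x y z : A.

(* Decides additive identities between words in the elements of the algebra. *)
Ltac nc_ring :=
  let K := fresh in let f := fresh in
  let fD := fresh in let fN := fresh in let f0 := fresh in
  apply: additive_ext => K f fD fN f0;
  rewrite ?(cmulDl, cmulDr, cmulNl, cmulNr, cmulA, cmul0l, cmul0r) ?(fD, fN, f0);
  ring.

Let d0 : d 0 = 0.
Proof. by apply: (addIr (d 0)); rewrite -d_add !add0r. Qed.

Let dN x : d (- x) = - d x.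
Proof. by apply: (addIr (d x)); rewrite -d_add !addNr d0. Qed.

(** Deduces an equation from another one when the two differ by a formal
    identity. *)
Lemma eq_of_sub (x y x' y' : A) : x = y -> x' - y' = x - y -> x' = y'.
Proof. by move=> -> /eqP; rewrite subrr subr_eq0 => /eqP. Qed.

(** The linearization of [d_sqr]. *)
Lemma jordan_mul x y :
  d (x ** y) + d (y ** x) = d x ** y + x ** d y + d y ** x + y ** d x.
Proof.
have := d_sqr (x + y); rewrite !(cmulDl, cmulDr) !d_add !d_sqr => /eq_of_sub; apply.
rewrite !(cmulDl, cmulDr); nc_ring.
Qed.

(** [2 (x y z + z y x)] is a combination of Jordan products,
    [{{x, y}, z} + {x, {y, z}} - {y, {x, z}}] with [{a, b} = a b + b a]. *)
Lemma jordan_triple_sym x y z :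
  d (x ** y ** z) + d (z ** y ** x)
  = d x ** y ** z + x ** d y ** z + x ** y ** d z
    + (d z ** y ** x + z ** d y ** x + z ** y ** d x).
Proof.
set L := LHS; set S := RHS; apply/eqP; rewrite -subr_eq0; apply/eqP/addxx_eq0.
have E : (x ** y + y ** x) ** z + z ** (x ** y + y ** x)
    + (x ** (y ** z + z ** y) + (y ** z + z ** y) ** x)
    = x ** y ** z + z ** y ** x + (x ** y ** z + z ** y ** x)
    + (y ** (x ** z + z ** x) + (x ** z + z ** x) ** y).
  nc_ring.
have /eq_of_sub := congr1 d (esym E); apply.
rewrite !d_add !jordan_mul !d_add.
have xy := jordan_mul x y; have yz := jordan_mul y z; have xz := jordan_mul x z.
rewrite xy yz xz /L /S; nc_ring.
Qed.

Lemma jordan_triple x y :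
  d (x ** y ** x) = d x ** y ** x + x ** d y ** x + x ** y ** d x.
Proof.
apply/eqP; rewrite -subr_eq0; apply/eqP/addxx_eq0.
have /eq_of_sub := jordan_triple_sym x y x; apply; nc_ring.
Qed.

Definition leibniz_defect x y := d (x ** y) - d x ** y - x ** d y.
Local Notation delta := leibniz_defect.
Local Notation "[~ x , y ]" := (x ** y - y ** x).

Lemma defect_anti x y : delta y x = - delta x y.
Proof.
have /eq_of_sub := jordan_mul x y; apply; rewrite /delta; nc_ring.
Qed.

Lemma defectDl x x' y : delta (x + x') y = delta x y + delta x' y.
Proof. rewrite /delta cmulDl !d_add; nc_ring. Qed.

Lemma defectDr x y y' : delta x (y + y') = delta x y + delta x y'.
Proof. rewrite /delta cmulDr !d_add; nc_ring. Qed.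

(** Apply [d] to [x y c y x + y x c x y] in two ways: as the symmetric triple
    product of [x y], [c] and [y x], and as the sum of [x (y c y) x] and
    [y (x c x) y]. The first way involves [d (x y)] and [d (y x)], the second
    does not. *)
Lemma defect_comm_anti x y c :
  delta x y ** c ** [~ x, y] + [~ x, y] ** c ** delta x y = 0.
Proof.
have E1 := jordan_triple_sym (x ** y) c (y ** x).
have E2 := jordan_triple x (y ** c ** y).
have E3 := jordan_triple y (x ** c ** x).
rewrite (jordan_triple y c) in E2; rewrite (jordan_triple x c) in E3.
have yx : d (y ** x) = d x ** y + x ** d y + d y ** x + y ** d x - d (x ** y).
  by rewrite -jordan_mul addrC addKr.
have E : d (x ** (y ** c ** y) ** x) + d (y ** (x ** c ** x) ** y) =
    d (x ** y ** c ** (y ** x)) + d (y ** x ** c ** (x ** y)).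
  by rewrite -!d_add; congr d; nc_ring.
rewrite E1 E2 E3 yx in E.
have /eq_of_sub := E; apply; rewrite /delta; nc_ring.
Qed.

Lemma defect_comm_same x y c : delta x y ** c ** [~ x, y] = 0.
Proof. exact/semiprime_anti/defect_comm_anti. Qed.

(** Linearizing [defect_comm_same] in [x] gives [lin]; it makes the product
    [p e p], with [p] the left-hand side, contain a factor
    [[x, y] e (delta x y) = 0], so that semiprimeness applies. *)
Lemma defect_comm_right x y z c : delta x y ** c ** [~ z, y] = 0.
Proof.
have lin e : delta x y ** e ** [~ z, y] = - (delta z y ** e ** [~ x, y]).
  have /eq_of_sub : delta (x + z) y ** e ** [~ x + z, y]
      - delta x y ** e ** [~ x, y] - delta z y ** e ** [~ z, y] = 0.
    by rewrite !defect_comm_same !subr0.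
  by apply; rewrite defectDl; move: (delta x y) (delta z y) => u v; nc_ring.
apply: cstar_semiprime => e; rewrite {1}lin.
have -> : - (delta z y ** c ** [~ x, y]) ** e ** (delta x y ** c ** [~ z, y])
    = - (delta z y ** c ** ([~ x, y] ** e ** delta x y) ** c ** [~ z, y]).
  by rewrite !(cmulNl, cmulA).
rewrite (semiprime_swap (defect_comm_same x y)).
by rewrite cmul0r !cmul0l oppr0.
Qed.

(** The same argument in the second variable. *)
Lemma defect_comm x y z t c : delta x y ** c ** [~ z, t] = 0.
Proof.
have lin e : delta x y ** e ** [~ z, t] = - (delta x t ** e ** [~ z, y]).
  have /eq_of_sub : delta x (y + t) ** e ** [~ z, y + t]
      - delta x y ** e ** [~ z, y] - delta x t ** e ** [~ z, t] = 0.
    by rewrite !defect_comm_right !subr0.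
  by apply; rewrite defectDr; move: (delta x y) (delta x t) => u v; nc_ring.
apply: cstar_semiprime => e; rewrite {1}lin.
have -> : - (delta x t ** c ** [~ z, y]) ** e ** (delta x y ** c ** [~ z, t])
    = - (delta x t ** c ** ([~ z, y] ** e ** delta x y) ** c ** [~ z, t]).
  by rewrite !(cmulNl, cmulA).
rewrite (semiprime_swap (fun c => defect_comm_right x y z c)).
by rewrite cmul0r !cmul0l oppr0.
Qed.

Lemma defect_central x y z : delta x y ** z = z ** delta x y.
Proof.
apply/eqP; rewrite -subr_eq0; apply/eqP/cstar_semiprime => c.
set u := delta x y.
have -> : [~ u, z] ** c ** [~ u, z]
    = u ** (z ** c) ** [~ u, z] - z ** (u ** c ** [~ u, z]).
  by rewrite cmulDl (cmulDl (u ** z ** c)) !cmulNl !cmulA.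
by rewrite !defect_comm cmul0r subr0.
Qed.

Lemma defect_mul_comm x y z t : delta x y ** [~ z, t] = 0.
Proof.
apply: cstar_semiprime => c.
have -> : delta x y ** [~ z, t] ** c ** (delta x y ** [~ z, t])
    = delta x y ** ([~ z, t] ** c ** delta x y) ** [~ z, t] by rewrite !cmulA.
exact: defect_comm.
Qed.

(** The defect [u] is central and [q = [x, y]] satisfies [u q = 0]. As
    [2 u = d q - [d x, y] - [x, d y]], multiplying by [u] leaves
    [2 u u = u (d q)]. The Jordan rule for [u] and [q] gives [u u (d q) = 0], so
    [u u u = 0], and a central nilpotent element of a semiprime algebra is
    zero. *)
Lemma defect_eq0 x y : delta x y = 0.
Proof.
set u := delta x y; set q := [~ x, y].
have uq0 : u ** q = 0 := defect_mul_comm x y x y.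
have qu0 : q ** u = 0 by rewrite -defect_central.
have uuE : u ** u + u ** u = u ** d q.
  have uu : u + u = d q - [~ d x, y] - [~ x, d y].
    rewrite -[in X in _ + X = _](opprK u) -defect_anti /u /delta /q d_add dN.
    nc_ring.
  rewrite -cmulDr uu cmulDr (cmulNr u) defect_mul_comm subr0.
  by rewrite cmulDr (cmulNr u) defect_mul_comm subr0.
have ddq0 : u ** (u ** d q) = 0.
  have uduq0 : u ** d u ** q = 0 := defect_comm x y x y (d u).
  have dqu : d q ** u = u ** d q by rewrite [RHS]defect_central.
  have := jordan_mul u q; clearbody q; rewrite uq0 qu0 d0 addr0 dqu.
  move/(congr1 (cmul u)); rewrite cmul0r !cmulDr !cmulA uduq0 uq0 cmul0l.
  rewrite addr0 add0r.
  by move/esym/addxx_eq0.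
have uuu0 : u ** u ** u = 0.
  by apply: addxx_eq0; rewrite -cmulA -cmulDr uuE ddq0.
have uu0 : u ** u = 0.
  apply: cstar_semiprime => c.
  have -> : u ** u ** c ** (u ** u) = u ** u ** (c ** u) ** u by rewrite !cmulA.
  by rewrite -(defect_central x y c) cmulA uuu0 !cmul0l.
apply: cstar_semiprime => c.
by rewrite (defect_central x y c) -cmulA uu0 cmul0r.
Qed.

(** Herstein's theorem on Jordan derivations. *)
Lemma jordan_derivation_leibniz x y : d (x ** y) = d x ** y + x ** d y.
Proof.
by have /eqP := defect_eq0 x y; rewrite /delta -addrA -opprD subr_eq0 => /eqP.
Qed.

End JordanDerivation.

(** * Weak-2-local derivations *)

Section WeakTwoLocal.
Variables (R : realType) (A : finDimCstarAlgType R) (Delta : A -> A).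
Hypothesis hDelta : is_weak_2_local_star_derivation Delta.
Implicit Types a b c h : A.

Let local2 h a b : exists2 D : A -> A, is_derivation D &
  regtr (h ** Delta a) = regtr (h ** D a) /\
  regtr (h ** Delta b) = regtr (h ** D b).
Proof.
by have [D [[Dder _] Ea Eb]] := hDelta a b (regtr_mul_bounded h); exists D.
Qed.

(** Expand [tau ((a + h) (Delta (a + h))) = 0]: the functional [tau (b _)] does
    not see the addition of [b] to the argument of [Delta], so only the two
    mixed terms remain. *)
Lemma form_skew a h : regtr (h ** Delta a) = - regtr (a ** Delta h).
Proof.
have self b : regtr (b ** Delta b) = 0.
  by have [D Dder [-> _]] := local2 b b b; apply: regtr_derivation_self.
have shift b c : regtr (b ** Delta (c + b)) = regtr (b ** Delta c).
  have [D Dder [-> ->]] := local2 b (c + b) c.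
  have [D_lin _] := Dder.
  have -> : D (c + b) = D c + D b by rewrite -[c]scale1r D_lin !scale1r.
  by rewrite cmulDr linearD /= (regtr_derivation_self _ Dder) addr0.
have := self (a + h); rewrite cmulDl linearD /= shift addrC.
rewrite (addrC a) shift => /eqP; rewrite addrC addr_eq0 => /eqP->.
by rewrite opprK.
Qed.

(** The form is linear in its left argument by construction, and skewness carries
    this over to the argument of [Delta]. *)
Lemma weak_2_local_linear : linear Delta.
Proof.
move=> k a b; apply: regtr_ext => z.
rewrite form_skew cmulDl cmulZl cmulDr cmulZr !linearD !linearZ /=.
by rewrite (form_skew a) (form_skew b).
Qed.

(** By skewness, [tau (c (Delta (a a))) = - tau (a a (Delta c))]; the part linear
    in [c] of [tau (a a (Delta a)) = 0] turns the right-hand side into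
    [tau (a c (Delta a)) + tau (c a (Delta a))]. *)
Lemma weak_2_local_sqr a : Delta (a ** a) = Delta a ** a + a ** Delta a.
Proof.
pose F : {linear A -> A} := HB.pack Delta
  (GRing.isLinear.Build _ _ _ _ Delta weak_2_local_linear).
have DeltaD b c : Delta (b + c) = Delta b + Delta c := linearD F b c.
have DeltaN b : Delta (- b) = - Delta b := linearN F b.
have cube b : regtr (b ** b ** Delta b) = 0.
  by have [D Dder [-> _]] := local2 (b ** b) b b; apply: regtr_derivation_sqr.
apply: regtr_ext => c; rewrite form_skew.
(* The part of the cubic form [cube] that is linear in c. *)
have polar : regtr (a ** a ** Delta c) + regtr (a ** c ** Delta a)
    + regtr (c ** a ** Delta a) = 0.
  apply/eqP; rewrite -(mulrI_eq0 _ (@mulfI _ 2%:R _)) ?pnatr_eq0 //; apply/eqP.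
  have <- : regtr ((a + c) ** (a + c) ** Delta (a + c))
      - regtr ((a - c) ** (a - c) ** Delta (a - c))
      - 2%:R * regtr (c ** c ** Delta c) = 0.
    by rewrite !cube subrr mulr0 subrr.
  rewrite !(DeltaD, DeltaN, cmulDl, cmulDr, cmulNl, cmulNr) !(regtrD, regtrN).
  ring.
have -> : regtr (c ** (Delta a ** a + a ** Delta a))
    = regtr (a ** c ** Delta a) + regtr (c ** a ** Delta a).
  by rewrite cmulDr regtrD !cmulA (regtrC _ a) cmulA.
by apply/eqP; rewrite eq_sym -addr_eq0 addrC addrA polar.
Qed.

End WeakTwoLocal.

Theorem corollary3p12 (R : realType) (A : finDimCstarAlgType R) (Delta : A -> A)
    (hDelta : is_weak_2_local_star_derivation Delta) :
  is_derivation Delta.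
Proof.
have Delta_lin := weak_2_local_linear hDelta.
split=> //; apply: jordan_derivation_leibniz; last exact: weak_2_local_sqr.
by move=> a b; rewrite -[a]scale1r Delta_lin !scale1r.
Qed.
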